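(* The deformed $q$-analog of the series $x\sum_{n=1}^{\infty}\frac{\binom{2n}{n}}{n(n+1)}x^{n}=2x\ln\left(\frac{1-\sqrt{1-4x}}{x}\right)+\frac{\sqrt{1-4x}}{2}+x(\ln4-1)-\frac{1}{2}$ is $$\sum_{n=1}^{\infty}\genfrac{[}{]}{0pt}{}{2n}{n}_{q}\frac{(-u/t)^{\binom{n}{2}}}{(-\sqrt{q};q)_{n}(-q;q)_{n}(1-q^{n})(1-q^{n+1})}\left(\frac{4x}{\sqrt{-t\varphi_{s,t}}}\right)^n=\frac{4(1-\sqrt{q})x}{(1-q)^2(1+q)\sqrt{-t\varphi_{s,t}}}\;{}_{3}\Phi_{2}\left(\begin{array}{c} q\sqrt{q},q,q \\ q^2,q^3 \end{array};q,-\frac{u}{t},\frac{-4ux}{t\sqrt{-t\varphi_{s,t}}}\right).$$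
   Context: Here $s,t$ are parameters, $\varphi_{s,t}=\frac{s+\sqrt{s^2+4t}}{2}$, $\varphi_{s,t}'=s-\varphi_{s,t}=-\frac{t}{\varphi_{s,t}}=\frac{s-\sqrt{s^2+4t}}{2}$, and $q=\varphi_{s,t}'/\varphi_{s,t}$; $u$ is the deformation parameter and $x$ is the variable. $(a;q)_0=1$ and $(a;q)_n=\prod_{k=0}^{n-1}(1-aq^k)$ for $n\ge1$; $(a_1,\dots,a_m;q)_n=(a_1;q)_n\cdots(a_m;q)_n$. The $q$-binomial coefficient is $\genfrac{[}{]}{0pt}{}{n}{k}_{q}=\frac{(q;q)_n}{(q;q)_k(q;q)_{n-k}}$. The deformed basic hypergeometric series is ${}_{r}\Phi_{m}\left(\begin{array}{c} a_1,\ldots,a_r \\ b_1,\ldots,b_{m} \end{array};q,v,z\right)=\sum_{n=0}^{\infty}v^{\binom n2}\frac{(a_1,\ldots,a_r;q)_n}{(q,b_1,\ldots,b_{m};q)_n}\bigl[(-1)^nq^{\binom n2}\bigr]^{1+m-r}z^n$; for $r=3$, $m=2$ the bracketed factor is $1$.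
   Formalization: The printed prefactor (1-q)^2(1+q) is corrected to (1-q)^3(1+q), since the printed identity is off by a factor 1-q; the quoted classical closed form (false as printed, its linear term should be x(1-ln 4)) is treated as motivation and not proved. *)

(* Defs.v *)
From mathcomp Require Export all_boot all_order all_algebra.
From mathcomp Require Export all_classical all_reals all_analysis.
From mathcomp Require Export complex.
Export Order.TTheory GRing.Theory Num.Theory.
Export numFieldNormedType.Exports.

Set Implicit Arguments.
Unset Strict Implicit.
Unset Printing Implicit Defensive.

Local Open Scope classical_set_scope.
Local Open Scope ring_scope.

Definition qpoch (K : fieldType) (a q : K) (n : nat) : K :=
  \prod_(k < n) (1 - a * q ^+ k).

Definition qpochs (K : fieldType) (s : seq K) (q : K) (n : nat) : K :=
  \prod_(a <- s) qpoch a q n.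

Definition qbinom (K : fieldType) (q : K) (n k : nat) : K :=
  qpoch q q n / (qpoch q q k * qpoch q q (n - k)).

(* [a_] and [b_] are the lists of upper and lower parameters, so that
   r = size a_ and m = size b_; the exponent 1 + m - r is an integer and may
   be negative. *)
Definition dhyper_term (K : fieldType) (a_ b_ : seq K) (q v z : K) (n : nat) : K :=
  v ^+ 'C(n, 2) * (qpochs a_ q n / qpochs (q :: b_) q n)
  * ((-1) ^+ n * q ^+ 'C(n, 2)) ^ ((1 + size b_)%:Z - (size a_)%:Z)
  * z ^+ n.

Definition psums (K : fieldType) (m : nat) (f : nat -> K) (N : nat) : K :=
  \sum_(m <= n < N) f n.

(* [limn] is an arbitrary value on divergent sequences, so statements about
   [sum_from] and [dhyper] are only meaningful together with [summable_from]. *)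
Definition summable_from (K : numFieldType) (m : nat) (f : nat -> K) : Prop :=
  cvgn (psums m f).

Definition sum_from (K : numFieldType) (m : nat) (f : nat -> K) : K :=
  limn (psums m f).

Definition dhyper (K : numFieldType) (a_ b_ : seq K) (q v z : K) : K :=
  sum_from 0 (dhyper_term a_ b_ q v z).

(* [rt] is a choice of square roots, i.e. (rt z)^2 = z for all z. *)
Definition phi_st (K : fieldType) (rt : K -> K) (s t : K) : K :=
  (s + rt (s ^+ 2 + 4 * t)) / 2.

Definition phi'_st (K : fieldType) (rt : K -> K) (s t : K) : K :=
  s - phi_st rt s t.

Definition q_st (K : fieldType) (rt : K -> K) (s t : K) : K :=
  phi'_st rt s t / phi_st rt s t.

(* Main.v *)
Require Import Defs.
From mathcomp Require Import ring.

Set Implicit Arguments.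
Unset Strict Implicit.
Unset Printing Implicit Defensive.

Local Open Scope ring_scope.
Local Open Scope complex_scope.

(** The identity holds term by term: the term of index [n + 1] on the left is a
    constant multiple of the term of index [n] on the right.  Write [p] for the
    chosen square root of [q].  Splitting the factors of [(q;q)_{2n}] by the
    parity of their index and factoring each [1 - p^(2k)] as a difference of
    squares gives
    [(q;q)_{2n} = (p;q)_n (-p;q)_n (q;q)_n (-q;q)_n] ([qpoch_double]), so the
    central [q]-binomial coefficient divided by [(-p;q)_n (-q;q)_n] is just
    [(p;q)_n / (q;q)_n] ([qbinom_central]).  After the shift [n -> n + 1], the
    first factor of each [q]-Pochhammer symbol splits off into the constant,
    [1 - q^(n+1)] and [1 - q^(n+2)] become quotients of consecutive shifted
    symbols, and [v^C(n+1,2) = v^C(n,2) v^n] moves one factor [v] per step into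
    the argument.  What is left is the term of the hypergeometric series
    ([central_term_dhyper]).  As [q] is not a root of unity, every denominator
    is nonzero: if [1 + p q^k] or [1 + q^(k+1)] vanished, squaring [p q^k = -1]
    or [q^(k+1) = -1] would make a positive power of [q] equal to [1].

    Proportional terms have proportional partial sums, hence proportional
    limits ([cvg_psums_shift]).  When the constant vanishes, so does the argument
    of the hypergeometric series, and then that series has a single nonzero
    term, so the two series are summable together in all cases. *)

Lemma qpochS_last (K : fieldType) (a q : K) n :
  qpoch a q n.+1 = qpoch a q n * (1 - a * q ^+ n).
Proof. by rewrite /qpoch big_ord_recr. Qed.

Lemma qpochS_first (K : fieldType) (a q : K) n :
  qpoch a q n.+1 = (1 - a) * qpoch (a * q) q n.
Proof.
rewrite /qpoch big_ord_recl expr0 mulr1; congr (_ * _).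
by apply: eq_bigr => i _; rewrite /= exprS mulrA.
Qed.

Lemma qpoch_neq0 (K : fieldType) (a q : K) n :
  (forall k, a * q ^+ k != 1) -> qpoch a q n != 0.
Proof.
by move=> aq; apply/prodf_neq0 => k _; rewrite subr_eq0 eq_sym aq.
Qed.

(** The factors [1 - p^(2k)] of odd [k = 2i + 1] split as
    [(1 - p q^i) (1 + p q^i)], those of even [k = 2i + 2] as
    [(1 - q q^i) (1 + q q^i)]. *)
Lemma qpoch_double (K : fieldType) (p q : K) n : p ^+ 2 = q ->
  qpoch q q (2 * n) = qpoch p q n * qpoch (- p) q n
                      * (qpoch q q n * qpoch (- q) q n).
Proof.
move=> pq; elim: n => [|n IHn]; first by rewrite muln0 /qpoch !big_ord0 !mulr1.
rewrite mulnS -[(2 + _)%N]/(2 * n).+2 !qpochS_last {}IHn (exprS q (2 * n)).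
have -> : q ^+ (2 * n) = (q ^+ n) ^+ 2 by rewrite -exprM mulnC.
by ring: pq.
Qed.

Section NonRootOfUnity.

Variables (K : fieldType) (q : K).
Hypothesis q_nru : forall n, (0 < n)%N -> q ^+ n != 1.

Let den_neq0 n : (0 < n)%N -> 1 - q ^+ n != 0.
Proof. by move=> n0; rewrite subr_eq0 eq_sym q_nru. Qed.

Lemma one_sub_neq0 : 1 - q != 0.
Proof. by rewrite -[X in 1 - X]expr1 den_neq0. Qed.

Lemma one_add_neq0 : 1 + q != 0.
Proof.
have := @den_neq0 2 isT.
by rewrite -[X in X - _](expr1n _ 2) subr_sqr mulf_eq0 negb_or => /andP[].
Qed.

(** A square root of [q] cannot be [1], since [q] itself is not; hence the
    proportionality constant between the two series, which is this quotient
    times [y], vanishes only for [y = 0]. *)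
Lemma prefactor_neq0 p : p ^+ 2 = q -> (1 - p) / ((1 - q) ^+ 3 * (1 + q)) != 0.
Proof.
move=> pq; have q1 := one_sub_neq0; have q2 := one_add_neq0.
rewrite mulf_neq0 ?invr_neq0 ?mulf_neq0 ?expf_neq0//.
apply: contra_neq q1 => p1.
by rewrite -pq -[X in X - _](expr1n _ 2) subr_sqr p1 mul0r.
Qed.

Lemma qpoch_expr_neq0 m n : (0 < m)%N -> qpoch (q ^+ m) q n != 0.
Proof. by move=> m0; apply: qpoch_neq0 => k; rewrite -exprD q_nru ?addn_gt0 ?m0. Qed.

(** A zero factor means [- a q^k = 1], whose square is [q^(m + 2k) = 1].  The
    cases of interest are [a = p], [m = 1] and [a = q], [m = 2]. *)
Lemma qpoch_opp_neq0 (a : K) m n : (0 < m)%N -> a ^+ 2 = q ^+ m ->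
  qpoch (- a) q n != 0.
Proof.
move=> m0 a2; apply: qpoch_neq0 => k; apply/eqP => ak1.
have /negP[] : q ^+ (m + k * 2) != 1 by rewrite q_nru ?addn_gt0 ?m0.
by rewrite exprD exprM -a2 -exprMn -sqrrN -mulNr ak1 expr1n.
Qed.

Lemma qbinom_central (p : K) n : p ^+ 2 = q ->
  qbinom q (2 * n) n / (qpoch (- p) q n * qpoch (- q) q n)
  = qpoch p q n / qpoch q q n.
Proof.
move=> pq; rewrite /qbinom (qpoch_double _ pq) [(2 * n - n)%N](_ : _ = n); last first.
  by rewrite mul2n -addnn addnK.
have ? : qpoch q q n != 0 by rewrite -[X in qpoch X]expr1 qpoch_expr_neq0.
have ? : qpoch (- p) q n != 0 by apply: (@qpoch_opp_neq0 _ 1); rewrite ?expr1.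
have ? : qpoch (- q) q n != 0 by apply: (@qpoch_opp_neq0 _ 2).
by field; do ?[apply/andP; split].
Qed.

(** The shift by one turns [v^C(n+1,2) y^(n+1)] into [v^C(n,2) (v y)^n] times
    [y]: this is why the series on the right has argument [v y], and where the
    factor [y] of the constant comes from.  The rest of the constant collects
    the first factors of the shifted symbols. *)
Lemma central_term_dhyper (p v y : K) n : p ^+ 2 = q ->
  qbinom q (2 * n.+1) n.+1
    * (v ^+ 'C(n.+1, 2)
       / (qpoch (- p) q n.+1 * qpoch (- q) q n.+1
          * (1 - q ^+ n.+1) * (1 - q ^+ n.+2)))
    * y ^+ n.+1
  = (1 - p) / ((1 - q) ^+ 3 * (1 + q)) * y
    * dhyper_term [:: q * p; q; q] [:: q ^+ 2; q ^+ 3] q v (v * y) n.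
Proof.
move=> pq.
(* The products A and B cancel against the binomial coefficient; the two linear
   denominators are set apart. *)
set A := qpoch (- p) q _; set B := qpoch (- q) q _.
have -> : forall b c d e : K, b * (c / (A * B * d * e)) = b / (A * B) * (c / (d * e)).
  by move=> b c d e; rewrite !invfM; ring.
rewrite (qbinom_central _ pq) /dhyper_term /qpochs !big_cons !big_nil /= expr0z.
rewrite binS bin1 exprD exprMn [y ^+ n.+1]exprS qpochS_first [p * q]mulrC.
have P1 : qpoch q q n != 0 by rewrite -[X in qpoch X]expr1 qpoch_expr_neq0.
have P2 : qpoch (q ^+ 2) q n != 0 by apply: qpoch_expr_neq0.
have P3 : qpoch (q ^+ 3) q n != 0 by apply: qpoch_expr_neq0.
have q1 := one_sub_neq0; have q2 := one_add_neq0.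
(* Both linear denominators are written with the symbols of the target series,
   through (1 - a) (aq;q)_n = (a;q)_n (1 - a q^n) for a = q and a = q^2. *)
have shift1 : 1 - q ^+ n.+1 = (1 - q) * qpoch (q ^+ 2) q n / qpoch q q n.
  apply: (mulIf P1); rewrite divfK// expr2 -qpochS_first qpochS_last -exprS.
  by rewrite mulrC.
have shift2 : 1 - q ^+ n.+2 = (1 - q ^+ 2) * qpoch (q ^+ 3) q n / qpoch (q ^+ 2) q n.
  apply: (mulIf P2); rewrite divfK// [q ^+ 3]exprSr -qpochS_first qpochS_last -exprD.
  by rewrite mulrC.
rewrite shift1 shift2 qpochS_first -expr2.
field.
by rewrite P1 P2 P3 q1 q2 /= (@den_neq0 2 isT).
Qed.

End NonRootOfUnity.

Section Summation.

Local Open Scope classical_set_scope.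

Variable K : numFieldType.

Lemma psumsS_shift (f g : nat -> K) c : (forall n, f n.+1 = c * g n) ->
  forall N, psums 1 f N.+1 = c * psums 0 g N.
Proof.
by move=> fg N; rewrite /psums big_add1 mulr_sumr; apply: eq_bigr => i _.
Qed.

Lemma cvg_psums_shift (f g : nat -> K) c : (forall n, f n.+1 = c * g n) ->
  summable_from 0 g -> psums 1 f @ \oo --> c * sum_from 0 g.
Proof.
move=> fg sg; rewrite -cvg_shiftS.
under eq_fun do rewrite (psumsS_shift fg).
by apply: cvgMr.
Qed.

Lemma summable_from_shift (f g : nat -> K) c : c != 0 ->
  (forall n, f n.+1 = c * g n) -> summable_from 1 f -> summable_from 0 g.
Proof.
move=> c0 fg sf; apply: (cvgP (c^-1 * sum_from 1 f)).
have -> : psums 0 g = fun N => c^-1 * psums 1 f N.+1.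
  by apply/funext => N; rewrite (psumsS_shift fg) mulKf.
by apply: cvgMr; rewrite cvg_shiftS.
Qed.

(** Covers the degenerate case [x = 0]: the proportionality constant vanishes
    there, so summability cannot be transported along it. *)
Lemma summable_from_head (g : nat -> K) : (forall n, g n.+1 = 0) ->
  summable_from 0 g.
Proof.
move=> g0; apply: (cvgP (g 0%N)); rewrite -cvg_shiftS.
under eq_fun do rewrite /psums big_nat_recl// big1 ?addr0//.
exact: cvg_cst.
Qed.

End Summation.

Theorem theorem8 (R : realType) (rt : R[i] -> R[i])
    (rt_sqr : forall z : R[i], rt z ^+ 2 = z)
    (s t u x : R[i]) :
  let phi := phi_st rt s t in
  let q := q_st rt s t in
  let lhs_term (n : nat) : R[i] :=
    qbinom q (2 * n) n
    * ((- u / t) ^+ 'C(n, 2)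
       / (qpoch (- rt q) q n * qpoch (- q) q n
          * (1 - q ^+ n) * (1 - q ^+ n.+1)))
    * (4 * x / rt (- t * phi)) ^+ n in
  let a_ := [:: q * rt q; q; q] in
  let b_ := [:: q ^+ 2; q ^+ 3] in
  let v := - u / t in
  let z := - 4 * u * x / (t * rt (- t * phi)) in
  t != 0 ->
  (forall n : nat, (0 < n)%N -> q ^+ n != 1) ->
  (summable_from 1 lhs_term <-> summable_from 0 (dhyper_term a_ b_ q v z)) /\
  (summable_from 0 (dhyper_term a_ b_ q v z) ->
   sum_from 1 lhs_term =
     4 * (1 - rt q) * x / ((1 - q) ^+ 3 * (1 + q) * rt (- t * phi))
     * dhyper a_ b_ q v z).
Proof.
move=> phi q f a_ b_ v z _ q_nru.
pose y := 4 * x / rt (- t * phi).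
have zE : z = v * y by rewrite /z /v /y invfM; ring.
pose d := (1 - rt q) / ((1 - q) ^+ 3 * (1 + q)).
have fE n : f n.+1 = d * y * dhyper_term a_ b_ q v z n.
  by rewrite zE; apply: central_term_dhyper.
have d0 : d != 0 by apply: prefactor_neq0.
have sum_f := cvg_psums_shift fE.
split; last first.
  rewrite /sum_from => /sum_f/cvg_lim -> //.
  by rewrite /dhyper /d /y; congr (_ * _); rewrite !invfM; ring.
split; last by move=> sg; exact: cvgP (sum_f sg).
have [y0 _|y0] := eqVneq y 0; last first.
  by apply: summable_from_shift fE; rewrite mulf_neq0.
apply: summable_from_head => n.
by rewrite /dhyper_term zE y0 mulr0 expr0n mulr0.
Qed.
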